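(* Let $(\varOmega,\alpha,m)$ be a measurable dynamical system over $\mathbb{R}^d$ that is ergodic and has pure point dynamical spectrum, with a countable basis of eigenfunctions. Then $(\varOmega,\alpha,m)$ has metric entropy $0$.
   Context: A measurable dynamical system $(\varOmega,\alpha,m)$ over $\mathbb{R}^d$ consists of a measurable space $(\varOmega,\mathcal{B})$, a measurable action $\alpha:\mathbb{R}^d\times\varOmega\to\varOmega$, $(x,\omega)\mapsto\alpha_x(\omega)$, and an $\alpha$-invariant probability measure $m$ on $(\varOmega,\mathcal B)$. It is ergodic if every $B\in\mathcal{B}$ that is $\alpha$-invariant up to sets of measure $0$ satisfies $m(B)\in\{0,1\}$. Pure point dynamical spectrum: the system gives a unitary representation $T$ of $\mathbb{R}^d$ on $L^2(\varOmega,m)$ by $T_xf=f\circ\alpha_x$. An element $f\in L^2(\varOmega,m)$ is an eigenfunction if $f\ne0$ and there is $\lambda$ in the dual group $\widehat{\mathbb{R}^d}$ with $T_xf=(\lambda,x)f$ for all $x\in\mathbb{R}^d$, where $(\lambda,x)$ is the value of the character $\lambda$ at $x$. The system has pure point dynamical spectrum if $L^2(\varOmega,m)$ has an orthonormal basis consisting of eigenfunctions. Metric entropy: this is the Kolmogorov-Sinai entropy of the action. It is the entropy of the restricted $\mathbb{Z}^d$-action, $\sup_{\mathcal P}\lim_{n\to\infty}\frac1{n^d}H_m\bigl(\bigvee_{x\in\{0,\dots,n-1\}^d}\alpha_x^{-1}\mathcal P\bigr)$. Here the supremum runs over finite measurable partitions $\mathcal P$ of $\varOmega$, and $H_m(\mathcal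 Q)=-\sum_{Q\in\mathcal Q}m(Q)\log m(Q)$. The choice of normalisation is irrelevant to whether the entropy vanishes. *)

(* Defs.v *)
(* MathComp-Analysis *)
From HB Require Import structures.
From mathcomp Require Import all_boot all_order all_algebra complex.
From mathcomp Require Import all_classical all_reals all_analysis.

Set Implicit Arguments.
Unset Strict Implicit.
Unset Printing Implicit Defensive.

Import Order.TTheory GRing.Theory Num.Theory.
Import numFieldNormedType.Exports.

Local Open Scope classical_set_scope.
Local Open Scope ring_scope.
Local Open Scope complex_scope.

Section dynamical_systems.
Context (R : realType) (d : nat) (disp : measure_display)
  (T : measurableType disp).
Implicit Types (alpha : 'rV[R]_d -> T -> T) (m : probability T R).

(* R^d carries its Borel sigma-algebra, and R^d * T the product one. *)
Record measurable_action alpha : Prop := {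
  measurable_action0 : forall w, alpha 0 w = w ;
  measurable_actionD : forall x y w, alpha (x + y) w = alpha x (alpha y w) ;
  measurable_action_measurable : measurable_fun setT
    (fun p : g_sigma_algebraType (@open 'rV[R]_d) * T => alpha p.1 p.2) }.

Definition invariant_measure alpha m : Prop :=
  forall x B, measurable B -> m (alpha x @^-1` B) = m B.

Record measurable_dynamical_system alpha m : Prop := {
  mds_action : measurable_action alpha ;
  mds_invariant : invariant_measure alpha m }.

Definition ergodic alpha m : Prop :=
  forall B, measurable B ->
    (forall x, m ((alpha x @^-1` B) `+` B) = 0%E) -> m B = 0%E \/ m B = 1%E.

(* Elements of L^2 are represented by functions; equality in L^2 is equality
   almost everywhere. *)
Definition L2 m (f : T -> R[i]) : Prop :=
  [/\ measurable_fun setT (fun w => complex.Re (f w)),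
      measurable_fun setT (fun w => complex.Im (f w)) &
      (\int[m]_w ((ComplexField.Normc.normc (f w)) ^+ 2)%:E < +oo)%E].

Definition inner m (f g : T -> R[i]) : R[i] :=
  (\int[m]_w complex.Re (f w * (g w)^*%C)) +i*
  (\int[m]_w complex.Im (f w * (g w)^*%C)).

(* The dual group of R^d: continuous homomorphisms into the unit circle. *)
Record character (chi : 'rV[R]_d -> R[i]) : Prop := {
  character_continuous :
    continuous (chi : 'rV[R]_d -> (R[i] : numFieldType)) ;
  character_norm1 : forall x, `|chi x| = 1 ;
  characterD : forall x y, chi (x + y) = chi x * chi y }.

Definition koopman alpha (x : 'rV[R]_d) (f : T -> R[i]) : T -> R[i] :=
  fun w => f (alpha x w).

Definition eigenfunction alpha m (f : T -> R[i]) : Prop :=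
  [/\ L2 m f, ~ (f = (fun=> 0) %[ae m]) &
      exists2 chi, character chi &
        forall x, koopman alpha x f = (fun w => chi x * f w) %[ae m]].

(* An orthonormal family of L^2 with dense linear span. *)
Record orthonormal_basis m (I : Type) (e : I -> T -> R[i]) : Prop := {
  onb_L2 : forall i, L2 m (e i) ;
  onb_norm1 : forall i, inner m (e i) (e i) = 1 ;
  onb_orthogonal : forall i j, i <> j -> inner m (e i) (e j) = 0 ;
  onb_dense : forall f, L2 m f -> forall eps : R, 0 < eps ->
    exists (s : seq I) (c : I -> R[i]),
      (\int[m]_w ((ComplexField.Normc.normc
         (f w - \sum_(i <- s) c i * e i w)) ^+ 2)%:E < eps%:E)%E }.

Definition eigenbasis alpha m (I : Type) (e : I -> T -> R[i]) : Prop :=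
  orthonormal_basis m e /\ forall i, eigenfunction alpha m (e i).

Definition countable_pure_point_spectrum alpha m : Prop :=
  exists (I : Type) (e : I -> T -> R[i]),
    countable [set: I] /\ eigenbasis alpha m e.

Definition measurable_partition (I : finType) (P : I -> set T) : Prop :=
  [/\ forall i, measurable (P i), trivIset setT P & \bigcup_i P i = setT].

(* ln 0 = 0, so that null (in particular empty) pieces contribute 0. *)
Definition partition_entropy m (I : finType) (P : I -> set T) : R :=
  - \sum_(i : I) fine (m (P i)) * ln (fine (m (P i))).

(* The common refinement of finitely many partitions; distinct indices phi
   give disjoint, possibly empty, pieces. *)
Definition join (J I : finType) (P : J -> I -> set T)
    (phi : {ffun J -> I}) : set T :=
  \bigcap_(j in [set: J]) P j (phi j).

Definition lattice_point (n : nat) (x : 'rV['I_n]_d) : 'rV[R]_d :=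
  map_mx (fun k : 'I_n => (k : nat)%:R) x.

Definition box_join alpha (I : finType) (P : I -> set T) (n : nat) :
    {ffun 'rV['I_n]_d -> I} -> set T :=
  join (fun (x : 'rV['I_n]_d) i => alpha (lattice_point x) @^-1` P i).

Definition partition_entropy_rate alpha m (I : finType) (P : I -> set T) : R :=
  limn (fun n => partition_entropy m (@box_join alpha I P n) / (n ^ d)%:R).

Definition metric_entropy alpha m : \bar R :=
  ereal_sup [set h | exists (k : nat) (P : 'I_k -> set T),
    measurable_partition P /\ h = (partition_entropy_rate alpha m P)%:E].

End dynamical_systems.

(* Main.v *)
(** The orbit of an eigenfunction consists of its multiples by numbers of modulus
    1, hence is totally bounded in L^2, and functions with totally bounded
    orbit are stable under sums, multiples and L^2-limits.  With pure point
    spectrum this applies to the function giving the index of the piece of a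
    finite partition P containing a point: for every eps there are finitely many
    group elements y_j such that every translate of P agrees with one of the
    translates by y_j outside a set of measure at most eps.  Hence the names of
    a point along a box of n^d translates are, up to a small error rate, noisy
    copies of its finitely many names along the y_j.  By Gibbs' inequality, the
    entropy of the join is at most its cross entropy with the law of the noisy
    copies of a uniformly random name, which is C + n^d eta with C independent
    of n.  This is o(n^d) if d > 0; for d = 0 the group acts trivially and
    ergodicity forces all measurable sets to have measure 0 or 1. *)
Require Import Defs.
From mathcomp Require Import all_boot all_order all_algebra complex ring lra.
From mathcomp Require Import all_classical all_reals all_analysis.
From mathcomp Require Import measurable_realfun.

Set Implicit Arguments.
Unset Strict Implicit.
Unset Printing Implicit Defensive.

Import Order.TTheory GRing.Theory Num.Theory.
Import numFieldNormedType.Exports.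

Local Open Scope classical_set_scope.
Local Open Scope ring_scope.
Local Open Scope complex_scope.

(** * Gibbs' inequality and the entropy of finite-valued maps *)

Lemma gibbs_ineq (R : realType) (J : finType) (p q : J -> R) :
  (forall j, 0 <= p j) -> (forall j, 0 < q j) ->
  \sum_j p j = 1 -> \sum_j q j = 1 ->
  - \sum_j p j * ln (p j) <= \sum_j p j * - ln (q j).
Proof.
move=> p0 q0 p1 q1; rewrite -sumrN -subr_ge0 -sumrB.
have pq : \sum_j (p j - q j) = 0 by rewrite sumrB p1 q1 subrr.
(* With [0] written as the sum of [p j - q j], it suffices to compare term by term, using
   [ln t <= t - 1] at [t = q j / p j]. *)
rewrite -[leLHS]pq; apply: ler_sum => j _.
have [->|pj0] := eqVneq (p j) 0; first by rewrite !mul0r; have := q0 j; lra.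
have pj : 0 < p j by rewrite lt_neqAle eq_sym pj0 p0.
suff : p j * (ln (q j) - ln (p j)) <= q j - p j by lra.
have -> : q j - p j = p j * (q j / p j - 1) by field.
rewrite ler_pM2l// -ln_div ?posrE//.
have := @le_ln1Dx R (q j / p j - 1).
rewrite [1 + _]addrC subrK; apply.
by have := divr_gt0 (q0 j) pj; lra.
Qed.

Section finite_valued.
Context (R : realType) (disp : measure_display) (T : measurableType disp).
Variable m : probability T R.

Lemma integral_probability_cst (r : R) : (\int[m]_w r%:E = r%:E)%E.
Proof.
rewrite (integral_cst m measurableT r%:E).
by rewrite [X in (_ * X)%E](@probability_setT _ _ _ m) mule1.
Qed.

Lemma measurable_finite_preimage (J : finType) (M : T -> J) (A : set J) :
  (forall j, measurable (M @^-1` [set j])) -> measurable (M @^-1` A).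
Proof.
move=> mM.
have -> : M @^-1` A = \bigcup_(j in A) (M @^-1` [set j]).
  apply/seteqP; split => [w Aw|w [j Aj] /= Mw]; first by exists (M w).
  by rewrite /preimage /= Mw.
by apply: fin_bigcup_measurable.
Qed.

Lemma measurable_finite_valued (J : finType) (M : T -> J) (g : J -> R) :
  (forall j, measurable (M @^-1` [set j])) ->
  measurable_fun setT (g \o M).
Proof.
move=> mM _ B _; rewrite setTI comp_preimage.
exact: measurable_finite_preimage.
Qed.

Lemma integral_finite_valued (J : finType) (M : T -> J) (g : J -> R) :
  (forall j, measurable (M @^-1` [set j])) -> (forall j, 0 <= g j) ->
  (\int[m]_w (g (M w))%:E = (\sum_j fine (m (M @^-1` [set j])) * g j)%:E)%E.
Proof.
move=> mM g0.
have E w : (g (M w))%:E =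
    (\sum_j ((g j)%:E * (\1_(M @^-1` [set j]) w)%:E))%E.
  rewrite (bigD1 (M w))//= big1 => [|j /eqP jM].
    by rewrite indicE mem_set// mule1 adde0.
  by rewrite indicE memNset ?mule0// => /= /esym.
under eq_integral do rewrite E.
rewrite ge0_integral_sum//=; last first.
- by move=> j w _; rewrite -EFinM lee_fin mulr_ge0.
- move=> j; apply/measurable_EFinP/measurable_funM => //.
rewrite -sumEFin; apply: eq_bigr => j _.
rewrite ge0_integralZl_EFin//; last exact/measurable_EFinP.
by rewrite integral_indic// setIT muleC EFinM fineK// fin_num_measure.
Qed.

Lemma measurable_disagree (I : finType) (f g : T -> I) :
  (forall i, measurable (f @^-1` [set i])) ->
  (forall i, measurable (g @^-1` [set i])) ->
  measurable [set w | f w <> g w].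
Proof.
move=> mf mg.
have -> : [set w | f w <> g w] =
    \bigcup_(i in setT) ((f @^-1` [set i]) `\` (g @^-1` [set i])).
  apply/seteqP; split => [w /= H|w [i _ /= [<-]]]; last by move=> H /esym.
  by exists (f w) => //; split=> // /esym.
by apply: fin_bigcup_measurable => // i _; exact: measurableD.
Qed.

Lemma sum_finite_valued (J : finType) (M : T -> J) :
  (forall j, measurable (M @^-1` [set j])) ->
  \sum_j fine (m (M @^-1` [set j])) = 1.
Proof.
move=> mM; apply: EFin_inj.
transitivity (\int[m]_w (1%:E : \bar R))%E.
  rewrite (integral_finite_valued (g := fun=> 1) mM)//.
  by under [in RHS]eq_bigr do rewrite mulr1.
exact: integral_probability_cst.
Qed.

(** Gibbs' inequality for the law of [M] against [q]; the cross entropy is written as an integral so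
    that [- ln q] can later be bounded pointwise. *)
Lemma partition_entropy_le (J : finType) (M : T -> J) (q : J -> R) :
  (forall j, measurable (M @^-1` [set j])) ->
  (forall j, 0 < q j) -> \sum_j q j = 1 ->
  ((partition_entropy m (fun j => M @^-1` [set j]))%:E <=
   \int[m]_w (- ln (q (M w)))%:E)%E.
Proof.
move=> mM q0 q1.
rewrite (integral_finite_valued (g := fun j => - ln (q j)) mM); last first.
  move=> j; rewrite oppr_ge0 ln_le0// -q1 (bigD1 j)//= lerDl.
  by rewrite sumr_ge0// => i _; exact: ltW.
rewrite lee_fin; apply: gibbs_ineq => // [j|]; last exact: sum_finite_valued.
exact: fine_ge0.
Qed.

Lemma partition_entropy_ge0 (J : finType) (P : J -> set T) :
  (forall j, measurable (P j)) -> 0 <= partition_entropy m P.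
Proof.
move=> mP; rewrite oppr_ge0 sumr_le0// => j _.
rewrite mulr_ge0_le0 ?fine_ge0// ln_le0//.
by rewrite -lee_fin fineK ?fin_num_measure// probability_le1.
Qed.

End finite_valued.

(** * Coding a join by noisy copies of finitely many names *)

Section coding.
Context (R : realType) (disp : measure_display) (T : measurableType disp).
Variable m : probability T R.
Context (X J I : finType) (Y : X -> T -> I) (Z : J -> T -> I) (c : X -> J).
Hypotheses (mY : forall x i, measurable (Y x @^-1` [set i]))
  (mZ : forall j i, measurable (Z j @^-1` [set i])).
Hypothesis I_gt0 : (0 < #|I|)%N.
Variable delta : R.
Hypotheses (delta_gt0 : 0 < delta) (delta_lt1 : delta < 1).

Let kappa : R := #|I|%:R.
Let kappa_gt0 : 0 < kappa. Proof. by rewrite ltr0n. Qed.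

(* A noisy channel that transmits [j] correctly with probability at least
   [1 - delta]. *)
Definition noise (j i : I) : R := delta / kappa + (1 - delta) *+ (i == j).

Lemma sum_noise j : \sum_i noise j i = 1.
Proof.
rewrite big_split/= sumr_const -/kappa (bigD1 j)//= eqxx big1 ?addr0.
  by rewrite -[_ *+ #|_|]mulr_natr mulfVK ?gt_eqF// mulr1n addrCA subrr addr0.
by move=> i /negbTE ->.
Qed.

Lemma noise_gt0 j i : 0 < noise j i.
Proof.
by rewrite ltr_pwDl ?divr_gt0// mulrn_wge0// subr_ge0 ltW.
Qed.

(** A correct symbol has probability at least [1 - delta] and a wrong one exactly [delta / kappa],
    so a mismatch adds at most [ln (kappa / delta)] to the cost. *)
Lemma ln_noise j i :
  - ln (noise j i) <= - ln (1 - delta) + ln (kappa / delta) * (i != j)%:R.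
Proof.
have dk : 0 < delta / kappa by rewrite divr_gt0.
have [ij|ij] := boolP (i == j).
  rewrite mulr0 addr0 lerN2 ler_ln ?posrE ?noise_gt0 ?subr_gt0//.
  by rewrite /noise ij lerDr ltW.
rewrite mulr1 /noise (negbTE ij) addr0 -[delta / kappa]invf_div lnV ?posrE.
  by rewrite opprK lerDr oppr_ge0 ln_le0// gerBl ltW.
by rewrite divr_gt0.
Qed.

(** The number of names along [J]. Its logarithm, the price of not knowing the name in advance, does
    not depend on [X]. *)
Let W : R := #|{ffun J -> I}|%:R.
Let W_gt0 : 0 < W. Proof. by rewrite ltr0n card_ffun expn_gt0 I_gt0. Qed.

(* The law of the noisy copies of a name [psi] drawn uniformly at random. *)
Definition mixture (phi : {ffun X -> I}) : R :=
  W^-1 * \sum_(psi : {ffun J -> I}) \prod_x noise (psi (c x)) (phi x).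

Lemma mixture_ge (psi : {ffun J -> I}) (phi : {ffun X -> I}) :
  W^-1 * \prod_x noise (psi (c x)) (phi x) <= mixture phi.
Proof.
rewrite ler_pM2l ?invr_gt0// (bigD1 psi)//= lerDl sumr_ge0// => ? _.
by apply: prodr_ge0 => x _; rewrite ltW// noise_gt0.
Qed.

Lemma prod_noise_gt0 (psi : {ffun J -> I}) (phi : {ffun X -> I}) :
  0 < \prod_x noise (psi (c x)) (phi x).
Proof. by apply: prodr_gt0 => x _; exact: noise_gt0. Qed.

Lemma mixture_gt0 phi : 0 < mixture phi.
Proof.
have /card_gt0P[i _] := I_gt0.
apply: lt_le_trans (mixture_ge [ffun=> i] phi).
by rewrite mulr_gt0 ?invr_gt0// prod_noise_gt0.
Qed.

Lemma sum_mixture : \sum_phi mixture phi = 1.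
Proof.
rewrite -mulr_sumr exchange_big/=.
under eq_bigr => psi _.
  (* By distributivity the sum over [phi] becomes a product over [x] of total masses of noise laws,
     each equal to 1. *)
  rewrite -(bigA_distr_bigA (fun x i => noise (psi (c x)) i))/=.
  rewrite big1; last by move=> x _; exact: sum_noise.
  over.
by rewrite sumr_const -/W mulVf// gt_eqF.
Qed.

(** A mixture dominates each of its components up to the weight [W^-1], whence [ln W]; the rest is
    the cost per symbol. *)
Lemma ln_mixture (psi : {ffun J -> I}) (phi : {ffun X -> I}) :
  - ln (mixture phi) <= ln W +
    \sum_x (- ln (1 - delta) + ln (kappa / delta) * (phi x != psi (c x))%:R).
Proof.
apply: (@le_trans _ _ (ln W + \sum_x - ln (noise (psi (c x)) (phi x)))).
  have := mixture_ge psi phi.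
  rewrite -ler_ln ?posrE ?mixture_gt0 ?mulr_gt0 ?invr_gt0 ?prod_noise_gt0//.
  rewrite lnM ?posrE ?invr_gt0 ?prod_noise_gt0// lnV ?posrE// sumrN.
  suff -> : ln (\prod_x noise (psi (c x)) (phi x)) =
    \sum_x ln (noise (psi (c x)) (phi x)) by lra.
  (* Positivity is carried along in the induction, because [ln] is additive only on positive
     factors. *)
  suff [] : 0 < \prod_x noise (psi (c x)) (phi x) /\
    ln (\prod_x noise (psi (c x)) (phi x)) =
    \sum_x ln (noise (psi (c x)) (phi x)) by [].
  apply: (big_ind2 (fun a b => 0 < a /\ ln a = b)); rewrite ?ln1//.
  - move=> a1 b1 a2 b2 [a1p <-] [a2p <-].
    by rewrite mulr_gt0// lnM ?posrE.
  - by move=> x _; rewrite noise_gt0.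
by rewrite lerD2l; apply: ler_sum => x _; exact: ln_noise.
Qed.

(** The name of [w] along [X] is coded as a noisy copy of its own name along [J]; on average at most
    [#|X| * eps] symbols are wrong. *)
Lemma join_entropy_le (eps : R) :
  0 <= eps ->
  (forall x, (m [set w | Y x w <> Z (c x) w] <= eps%:E)%E) ->
  partition_entropy m
    (fun phi : {ffun X -> I} => [set w | [ffun x => Y x w] = phi]) <=
  ln W + #|X|%:R * (- ln (1 - delta) + ln (kappa / delta) * eps).
Proof.
move=> eps0 mD.
have kd : 0 <= ln (kappa / delta).
  rewrite ln_ge0// ler_pdivlMr// mul1r (le_trans (ltW delta_lt1))//.
  by rewrite ler1n.
have d1 : 0 <= - ln (1 - delta) by rewrite oppr_ge0 ln_le0// gerBl ltW.
have W1 : 0 <= ln W.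
  by rewrite ln_ge0// ler1n card_ffun expn_gt0 I_gt0.
have mM phi : measurable ((fun w => [ffun x => Y x w]) @^-1` [set phi]).
  have -> : (fun w => [ffun x => Y x w]) @^-1` [set phi] =
      \bigcap_(x in setT) (Y x @^-1` [set phi x]).
    apply/seteqP; split => [w <- x _/=|w H]; first by rewrite ffunE.
    by apply/ffunP => x; rewrite ffunE; apply: H.
  by apply: fin_bigcap_measurable => // x _.
have mDx x : measurable [set w | Y x w <> Z (c x) w].
  exact: measurable_disagree.
have mF x : measurable_fun setT (fun w => ((- ln (1 - delta))%:E +
     (ln (kappa / delta))%:E * (\1_[set w | Y x w <> Z (c x) w] w)%:E)%E).
  apply/measurable_EFinP/measurable_funD => //.
  by apply/measurable_funM.
rewrite -lee_fin.
have H := partition_entropy_le m mM mixture_gt0 sum_mixture.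
apply: (le_trans H) => {H}.
apply: (@le_trans _ _ (\int[m]_w ((ln W)%:E + \sum_x ((- ln (1 - delta))%:E +
   (ln (kappa / delta))%:E * (\1_[set w | Y x w <> Z (c x) w] w)%:E)))%E).
  apply: ge0_le_integral => //.
  - move=> w _; rewrite lee_fin oppr_ge0 ln_le0// -sum_mixture.
    rewrite (bigD1 [ffun x => Y x w])//= lerDl sumr_ge0// => i _.
    exact/ltW/mixture_gt0.
  - apply/measurable_EFinP.
    exact: (measurable_finite_valued (fun phi => - ln (mixture phi)) mM).
  - by apply: emeasurable_funD => //; apply: emeasurable_sum.
  - move=> w _.
    under eq_bigr do rewrite -EFinM -EFinD.
    rewrite sumEFin -EFinD lee_fin.
    (* The bound on [mixture] holds for every [psi], so [psi] may vary with [w]: it is taken to be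
       the name of [w] along [J]. *)
    have := ln_mixture [ffun j => Z j w] [ffun x => Y x w].
    under eq_bigr => x _.
      rewrite !ffunE.
      have -> : (Y x w != Z (c x) w)%:R =
          \1_[set w | Y x w <> Z (c x) w] w :> R.
        rewrite indicE; congr (_%:R); congr nat_of_bool.
        by apply/idP/idP; rewrite inE/= => /eqP.
      over.
    by [].
have F0 x w : (0 <= ((- ln (1 - delta))%:E +
     (ln (kappa / delta))%:E * (\1_[set w | Y x w <> Z (c x) w] w)%:E))%E.
  by rewrite lee_fin addr_ge0// mulr_ge0.
rewrite ge0_integralD//; last 2 first.
- by move=> w _; apply: sume_ge0.
- exact: emeasurable_sum.
rewrite integral_probability_cst EFinD leeD2l//.
rewrite ge0_integral_sum//.
have -> : #|X|%:R * (- ln (1 - delta) + ln (kappa / delta) * eps) =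
   \sum_(x : X) (- ln (1 - delta) + ln (kappa / delta) * eps).
  by rewrite sumr_const mulr_natl.
rewrite -sumEFin; apply: lee_sum => x _.
rewrite ge0_integralD//; last first.
- by apply/measurable_EFinP/measurable_funM.
- by move=> w _; rewrite lee_fin mulr_ge0.
rewrite integral_probability_cst EFinD leeD2l//.
rewrite ge0_integralZl_EFin//; last exact/measurable_EFinP.
rewrite integral_indic// setIT EFinM.
by apply: lee_wpmul2l; rewrite ?lee_fin//; exact: mD.
Qed.

End coding.

(** * Finite colourings and representatives of colours *)

Lemma finite_colouring (R : realType) (X : Type) (u : X -> R) (eta : R) :
  0 < eta ->
  (forall x, `|u x| <= 1) ->
  exists (J : finType) (c : X -> J),
    forall x y, c x = c y -> `|u x - u y| < eta.
Proof.
move=> eta0 u1.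
have u0 x : 0 <= (u x + 1) / eta.
  by apply: divr_ge0; last exact: ltW; have := u1 x; rewrite ler_norml; lra.
(* The interval from -1 to 1 is cut into pieces of length [eta], and [h x] is the number of the
   piece containing [u x]. Adding 1 keeps the truncated quotient nonnegative, and [K] bounds the
   numbers. *)
pose K := Num.trunc (2 / eta).
pose h x := Num.trunc ((u x + 1) / eta).
have hK x : (h x < K.+1)%N.
  rewrite ltnS; apply: le_truncn; rewrite ler_pM2r ?invr_gt0//.
  by have := u1 x; rewrite ler_norml; lra.
exists 'I_K.+1, (fun x => inord (h x)) => x y /(congr1 val).
rewrite /= !inordK// => hxy.
have /andP[a1 a2] := truncn_itv (u0 x).
have /andP[b1 b2] := truncn_itv (u0 y).
rewrite -/(h _) -?/(h x) in a1 a2 b1 b2.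
have {}a1 : (h y)%:R <= (u x + 1) / eta by rewrite -hxy.
have {}a2 : (u x + 1) / eta < (h y).+1%:R by rewrite -hxy.
rewrite ler_pdivlMr// in a1; rewrite ltr_pdivrMr// in a2.
rewrite ler_pdivlMr// in b1; rewrite ltr_pdivrMr// in b2.
by rewrite -natr1 mulrDl mul1r in a2 b2; rewrite ltr_norml; lra.
Qed.

(** A representative is chosen in each colour class; colours that are not attained get the default
    [point], which the conclusion never sees. *)
Lemma colouring_section (X : pointedType) (J : finType) (c : X -> J) :
  exists y : J -> X, forall x, c (y (c x)) = c x.
Proof.
exists (fun j => xget point [set x | c x = j]) => x.
by apply: (@xgetPex _ point [set z | c z = c x]); exists x.
Qed.

(** * Functions with totally bounded orbit in L^2 *)

Section almost_periodicity.
Context (R : realType) (d : nat) (disp : measure_display)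
  (T : measurableType disp) (alpha : 'rV[R]_d -> T -> T) (m : probability T R).
Hypothesis dyn : measurable_dynamical_system alpha m.

(** The squared modulus as a real polynomial in the two coordinates, free of square roots. *)
Definition sqn (z : R[i]) : R := complex.Re z ^+ 2 + complex.Im z ^+ 2.

Lemma sqn_ge0 z : 0 <= sqn z.
Proof. by rewrite addr_ge0// sqr_ge0. Qed.

(** The parallelogram identity with the term of [z - w] dropped; it stands in for the triangle
    inequality. *)
Lemma sqnD z w : sqn (z + w) <= 2 * (sqn z + sqn w).
Proof.
case: z w => [a b] [c e]; rewrite /sqn/=.
have := sqr_ge0 (a - c); have := sqr_ge0 (b - e); nra.
Qed.

Lemma sqnM z w : sqn (z * w) = sqn z * sqn w.
Proof. by case: z w => [a b] [c e]; rewrite /sqn/=; ring. Qed.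

Lemma normc_sqn z : ComplexField.Normc.normc z ^+ 2 = sqn z.
Proof. by case: z => a b; rewrite /= sqr_sqrtr// addr_ge0// sqr_ge0. Qed.

Lemma sqn_norm1 z : `|z| = 1 -> sqn z = 1.
Proof.
move=> z1; apply: complexI.
by rewrite add_Re2_Im2 z1 expr1n.
Qed.

Definition cmeasurable (f : T -> R[i]) :=
  measurable_fun setT (fun w => complex.Re (f w)) /\
  measurable_fun setT (fun w => complex.Im (f w)).

Lemma measurable_sqn f : cmeasurable f ->
  measurable_fun setT (fun w => (sqn (f w))%:E).
Proof.
move=> [mR mI]; apply/measurable_EFinP.
by apply: measurable_funD; apply: measurable_funX.
Qed.

Lemma cmeasurableD f g : cmeasurable f -> cmeasurable g ->
  cmeasurable (fun w => f w + g w).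
Proof.
move=> [fR fI] [gR gI]; split.
- have -> : (fun w => complex.Re (f w + g w)) =
      (fun w => complex.Re (f w) + complex.Re (g w)).
    by apply/funext => w; case: (f w) (g w) => [? ?] [? ?].
  exact: measurable_funD.
- have -> : (fun w => complex.Im (f w + g w)) =
      (fun w => complex.Im (f w) + complex.Im (g w)).
    by apply/funext => w; case: (f w) (g w) => [? ?] [? ?].
  exact: measurable_funD.
Qed.

Lemma cmeasurableZ c f : cmeasurable f -> cmeasurable (fun w => c * f w).
Proof.
case: c => a b [fR fI]; split.
- have -> : (fun w => complex.Re ((a +i* b) * f w)) =
      (fun w => a * complex.Re (f w) - b * complex.Im (f w)).
    by apply/funext => w; case: (f w).
  by apply: measurable_funB; apply: measurable_funM.
- have -> : (fun w => complex.Im ((a +i* b) * f w)) =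
      (fun w => a * complex.Im (f w) + b * complex.Re (f w)).
    by apply/funext => w; case: (f w).
  by apply: measurable_funD; apply: measurable_funM.
Qed.

Lemma cmeasurableB f g : cmeasurable f -> cmeasurable g ->
  cmeasurable (fun w => f w - g w).
Proof.
move=> mf mg.
have -> : (fun w => f w - g w) = (fun w => f w + (-1) * g w).
  by apply/funext => w; rewrite mulN1r.
exact/cmeasurableD/cmeasurableZ.
Qed.

Lemma measurable_shift x : measurable_fun setT (alpha x).
Proof.
have [[_ _ mal] _] := dyn.
exact: (measurable_fun_pair2 (x : g_sigma_algebraType (@open 'rV[R]_d)) mal).
Qed.

Lemma cmeasurable_shift f x :
  cmeasurable f -> cmeasurable (fun w => f (alpha x w)).
Proof.
move=> [fR fI]; split.
- exact: (measurableT_comp fR (measurable_shift x)).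
- exact: (measurableT_comp fI (measurable_shift x)).
Qed.

Definition sqnorm (f : T -> R[i]) : \bar R := (\int[m]_w (sqn (f w))%:E)%E.

Lemma sqnorm_ge0 f : (0 <= sqnorm f)%E.
Proof. by apply: integral_ge0 => w _; rewrite lee_fin sqn_ge0. Qed.

Lemma sqnormD f g : cmeasurable f -> cmeasurable g ->
  (sqnorm (fun w => f w + g w)%R <= 2%:E * (sqnorm f + sqnorm g))%E.
Proof.
move=> mf mg; rewrite /sqnorm -ge0_integralD//; first last.
- exact: measurable_sqn.
- by move=> w _; rewrite lee_fin sqn_ge0.
- exact: measurable_sqn.
- by move=> w _; rewrite lee_fin sqn_ge0.
rewrite -ge0_integralZl_EFin//; first last.
- by apply: emeasurable_funD; exact: measurable_sqn.
- by move=> w _; rewrite adde_ge0// lee_fin sqn_ge0.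
apply: ge0_le_integral => //.
- by move=> w _; rewrite lee_fin sqn_ge0.
- by apply/measurable_sqn/cmeasurableD.
- apply/measurable_EFinP/measurable_funM => //.
  by apply: measurable_funD; apply/measurable_EFinP; exact: measurable_sqn.
- by move=> w _; rewrite -EFinD -EFinM lee_fin sqnD.
Qed.

Lemma sqnormZ c f : cmeasurable f ->
  sqnorm (fun w => c * f w) = ((sqn c)%:E * sqnorm f)%E.
Proof.
move=> mf; rewrite -ge0_integralZl_EFin ?sqn_ge0//; first last.
- exact: measurable_sqn.
- by move=> w _; rewrite lee_fin sqn_ge0.
by apply: eq_integral => w _; rewrite sqnM EFinM.
Qed.

(** Change of variables: by invariance the image of [m] under [alpha x] is [m]. *)
Lemma sqnorm_shift f x : cmeasurable f ->
  sqnorm (fun w => f (alpha x w)) = sqnorm f.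
Proof.
move=> mf.
transitivity (\int[pushforward m (alpha x)]_w (sqn (f w))%:E)%E.
  rewrite (ge0_integral_pushforward (measurable_shift x))//.
  - exact: measurable_sqn.
  - by move=> w _; rewrite lee_fin sqn_ge0.
apply: eq_measure_integral => [|Hx A mA _]; first exact: measurable_shift.
by have [_] := dyn; apply.
Qed.

Lemma sqnorm_ae_eq f g : cmeasurable f -> cmeasurable g ->
  f = g %[ae m] -> sqnorm f = sqnorm g.
Proof.
move=> mf mg fg; apply: ge0_ae_eq_integral => //.
- exact: measurable_sqn.
- exact: measurable_sqn.
- by move=> w _; rewrite lee_fin sqn_ge0.
- by move=> w _; rewrite lee_fin sqn_ge0.
by apply: filterS fg => w /= fgw Dw; rewrite fgw.
Qed.

(* Total boundedness of the orbit of [f] in [L^2], phrased with a finite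
   colouring of the group. *)
Definition almost_periodic (f : T -> R[i]) := cmeasurable f /\
  forall eps : R, 0 < eps -> exists (J : finType) (c : 'rV[R]_d -> J),
    forall x y, c x = c y ->
      (sqnorm (fun w => (f (alpha x w) - f (alpha y w))%R) < eps%:E)%E.

Lemma almost_periodic0 : almost_periodic (fun=> 0).
Proof.
split; first by split; exact: measurable_cst.
move=> eps eps0; exists unit, (fun=> tt) => x y _.
rewrite /sqnorm integral0_eq ?lte_fin// => w _.
by rewrite subrr /sqn/= expr0n addr0.
Qed.

Lemma almost_periodicD f g : almost_periodic f -> almost_periodic g ->
  almost_periodic (fun w => f w + g w).
Proof.
move=> [mf apf] [mg apg]; split; first exact: cmeasurableD.
move=> eps eps0; have eps4 : 0 < eps / 4 by rewrite divr_gt0.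
have [J1 [c1 H1]] := apf _ eps4; have [J2 [c2 H2]] := apg _ eps4.
(* The pair of colours controls both summands at once; [sqnormD] then gives
   [2 * (eps / 4 + eps / 4) = eps]. *)
exists (J1 * J2)%type, (fun x => (c1 x, c2 x)) => x y [/H1 h1 /H2 h2].
have -> : (fun w => f (alpha x w) + g (alpha x w) -
      (f (alpha y w) + g (alpha y w))) =
    (fun w => (f (alpha x w) - f (alpha y w)) +
       (g (alpha x w) - g (alpha y w))).
  by apply/funext => w; ring.
apply: le_lt_trans (sqnormD _ _) _.
- by apply: cmeasurableB; exact: cmeasurable_shift.
- by apply: cmeasurableB; exact: cmeasurable_shift.
have -> : eps%:E = (2%:E * ((eps / 4)%:E + (eps / 4)%:E))%E.
  by rewrite -EFinD -EFinM; congr EFin; field.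
by rewrite lte_pmul2l// lteD.
Qed.

Lemma almost_periodicZ a f : almost_periodic f ->
  almost_periodic (fun w => a * f w).
Proof.
move=> [mf apf]; split; first exact: cmeasurableZ.
(* The added 1 covers the case [a = 0]. *)
move=> eps eps0; have a0 : 0 < sqn a + 1 by rewrite ltr_wpDl// sqn_ge0.
have [J [c H]] := apf _ (divr_gt0 eps0 a0).
exists J, c => x y /H h.
have -> : (fun w => a * f (alpha x w) - a * f (alpha y w)) =
    (fun w => a * (f (alpha x w) - f (alpha y w))).
  by apply/funext => w; ring.
rewrite sqnormZ; last by apply: cmeasurableB; exact: cmeasurable_shift.
apply: (@le_lt_trans _ _ ((sqn a + 1)%:E *
    sqnorm (fun w => f (alpha x w) - f (alpha y w))%R)%E).
  by rewrite lee_wpmul2r ?sqnorm_ge0// lee_fin lerDl.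
have -> : eps%:E = ((sqn a + 1)%:E * (eps / (sqn a + 1))%:E)%E.
  by rewrite -EFinM mulrC divfK// gt_eqF.
by rewrite lte_pmul2l.
Qed.

Lemma almost_periodic_sum (I : Type) (s : seq I) (c : I -> R[i])
    (e : I -> T -> R[i]) :
  (forall i, almost_periodic (e i)) ->
  almost_periodic (fun w => \sum_(i <- s) c i * e i w).
Proof.
move=> ape; elim: s => [|i s IH].
  by under eq_fun do rewrite big_nil; exact: almost_periodic0.
by under eq_fun do rewrite big_cons; exact/almost_periodicD/IH/almost_periodicZ.
Qed.

(** The usual three-term splitting: the two errors [f - g] are taken at shifted points, and
    invariance makes them as small as the unshifted one. *)
Lemma almost_periodic_closed f : cmeasurable f ->
  (forall eps, 0 < eps -> exists2 g, almost_periodic g &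
     (sqnorm (fun w => f w - g w)%R < eps%:E)%E) ->
  almost_periodic f.
Proof.
move=> mf approx; split => // eps eps0.
(* Two uses of [sqnormD] give [2 * (e + 2 * (e + e)) = 10 * e]. *)
have eps10 : 0 < eps / 10 by rewrite divr_gt0.
have [g [mg apg] fg] := approx _ eps10.
have [J [c H]] := apg _ eps10.
exists J, c => x y /H h.
have mfg : cmeasurable (fun w => f w - g w) by exact: cmeasurableB.
have -> : (fun w => f (alpha x w) - f (alpha y w)) =
    (fun w => (f (alpha x w) - g (alpha x w)) +
    ((g (alpha x w) - g (alpha y w)) + -1 * (f (alpha y w) - g (alpha y w)))).
  by apply/funext => w; ring.
have m1 := cmeasurable_shift x mfg.
have m2 := cmeasurableZ (-1) (cmeasurable_shift y mfg).
have m3 : cmeasurable (fun w => g (alpha x w) - g (alpha y w)).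
  by apply: cmeasurableB; exact: cmeasurable_shift.
apply: le_lt_trans (sqnormD m1 (cmeasurableD m3 m2)) _.
have E1 : sqnorm (fun w => f (alpha x w) - g (alpha x w)) =
  sqnorm (fun w => f w - g w) := sqnorm_shift x mfg.
have E2 : sqnorm (fun w => -1 * (f (alpha y w) - g (alpha y w))) =
    sqnorm (fun w => f w - g w).
  rewrite (sqnormZ _ (cmeasurable_shift y mfg)).
  have -> : sqn (-1) = 1 by rewrite /sqn/= oppr0 expr0n addr0 sqrrN expr1n.
  by rewrite mul1e; exact: (sqnorm_shift y mfg).
rewrite E1.
have h2 := sqnormD m3 m2; rewrite E2 in h2.
apply: (@le_lt_trans _ _ (2%:E * (sqnorm (fun w => f w - g w)%R +
   2%:E * (sqnorm (fun w => g (alpha x w) - g (alpha y w))%R +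
     sqnorm (fun w => f w - g w)%R)))%E).
  by rewrite lee_pmul2l// leeD2l.
apply: (@lt_le_trans _ _
    (2%:E * ((eps / 10)%:E + 2%:E * ((eps / 10)%:E + (eps / 10)%:E)))%E).
  by rewrite lte_pmul2l// lteD// lte_pmul2l// lteD.
by rewrite -!(EFinD, EFinM) lee_fin; lra.
Qed.

(** Two translates of [f] differ almost everywhere by the factor [chi x - chi y], so it suffices to
    colour the values of [chi] on the unit circle. *)
Lemma almost_periodic_eigenfunction f :
  eigenfunction alpha m f -> almost_periodic f.
Proof.
move=> [[fR fI fint] _ [chi [_ chi1 _] fchi]].
have mf : cmeasurable f by [].
have {}fint : (sqnorm f < +oo)%E.
  by apply: le_lt_trans fint; under eq_integral do rewrite normc_sqn.
have ffin : sqnorm f \is a fin_num by rewrite ge0_fin_numE// sqnorm_ge0.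
split => // eps eps0.
pose K := fine (sqnorm f) + 1.
have K0 : 0 < K by rewrite ltr_wpDl// fine_ge0// sqnorm_ge0.
(* Since [eta <= 1], also [eta * eta <= eps / (2 * K)]: each of the two coordinates contributes at
   most half of [eps / K]. *)
pose eta := Num.min 1 (eps / (2 * K)).
have eK : 0 < eps / (2 * K) by rewrite divr_gt0// mulr_gt0.
have eta0 : 0 < eta by rewrite lt_min ltr01.
have bnd x : `|complex.Re (chi x)| <= 1 /\ `|complex.Im (chi x)| <= 1.
  have := sqn_norm1 (chi1 x); case: (chi x) => a b; rewrite /sqn/= => ab.
  by split; rewrite ler_norml; apply/andP; split; nra.
have [J1 [c1 H1]] := finite_colouring eta0 (fun x => (bnd x).1).
have [J2 [c2 H2]] := finite_colouring eta0 (fun x => (bnd x).2).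
exists (J1 * J2)%type, (fun x => (c1 x, c2 x)) => x y [/H1 h1 /H2 h2].
have -> : sqnorm (fun w => f (alpha x w) - f (alpha y w)) =
    sqnorm (fun w => (chi x - chi y) * f w).
  apply: sqnorm_ae_eq.
  - by apply: cmeasurableB; exact: cmeasurable_shift.
  - exact: cmeasurableZ.
  have fx := fchi x; have fy := fchi y.
  apply: filterS2 fx fy => w /= fxw fyw Dw.
  by rewrite mulrBl -fxw// -fyw.
rewrite sqnormZ//.
rewrite -(fineK ffin) -EFinM lte_fin.
have sq : sqn (chi x - chi y) < eps / K.
  move: h1 h2; case: (chi x) (chi y) => [a b] [c e]; rewrite /sqn/=.
  have eta_le : eta * eta <= eps / (2 * K).
    have : eta <= 1 by rewrite ge_min lexx.
    have : eta <= eps / (2 * K) by rewrite ge_min lexx orbT.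
    by nra.
  have -> : eps / K = eps / (2 * K) + eps / (2 * K).
    by field; rewrite gt_eqF.
  rewrite !ltr_norml => /andP[? ?] /andP[? ?].
  by apply: ltrD; apply: lt_le_trans eta_le; nra.
apply: (@le_lt_trans _ _ (sqn (chi x - chi y) * K)).
  by apply: ler_wpM2l; rewrite ?sqn_ge0// lerDl.
by rewrite -ltr_pdivlMr.
Qed.

Lemma almost_periodic_L2 f : countable_pure_point_spectrum alpha m ->
  L2 m f -> almost_periodic f.
Proof.
move=> [I [e [_ [[_ _ _ dense] eig]]]] L2f.
have [fR fI _] := L2f.
apply: almost_periodic_closed => // eps eps0.
have [s [c H]] := dense f L2f eps eps0.
exists (fun w => \sum_(i <- s) c i * e i w).
  by apply: almost_periodic_sum => i; exact: almost_periodic_eigenfunction.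
by apply: le_lt_trans H; under [in leRHS]eq_integral do rewrite normc_sqn.
Qed.

End almost_periodicity.

(** * From almost periodicity to vanishing entropy *)

Section entropy.
Context (R : realType) (d : nat) (disp : measure_display)
  (T : measurableType disp) (alpha : 'rV[R]_d -> T -> T) (m : probability T R).
Hypothesis dyn : measurable_dynamical_system alpha m.

Lemma partition_index (I : finType) (P : I -> set T) :
  measurable_partition P -> exists N : T -> I, forall i, P i = N @^-1` [set i].
Proof.
move=> [_ tP cP].
have H w : exists i, P i w.
  have : (\bigcup_i P i) w by rewrite cP.
  by move=> [i _ Pi]; exists i.
have [N HN] := choice H.
exists N => i; apply/seteqP; split => [w Pw|w /= <-//].
by apply: tP => //; exists w.
Qed.

Lemma box_join_index (I : finType) (P : I -> set T) (N : T -> I) n :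
  (forall i, P i = N @^-1` [set i]) ->
  @box_join R d disp T alpha I P n =
  fun phi => [set w | [ffun x => N (alpha (lattice_point R x) w)] = phi].
Proof.
move=> PN; apply/funext => phi; apply/seteqP; split => [w H|w <- x _ /=].
  by apply/ffunP => x; rewrite ffunE; have := H x Logic.I; rewrite /= PN.
by rewrite ffunE PN.
Qed.

Hypothesis pps : countable_pure_point_spectrum alpha m.

(** Distinct indices differ by at least 1, so the measure of the disagreement set is at most the
    squared L^2 distance of the two translates of the index function. *)
Lemma index_colouring (k : nat) (N : T -> 'I_k) :
  (forall i, measurable (N @^-1` [set i])) ->
  forall eps : R, 0 < eps -> exists (J : finType) (c : 'rV[R]_d -> J),
    forall x y, c x = c y ->
      (m [set w | N (alpha x w) <> N (alpha y w)] < eps%:E)%E.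
Proof.
move=> mN.
pose f (w : T) : R[i] := (N w)%:R +i* 0.
have mf : cmeasurable f.
  split; last exact: measurable_cst.
  exact: (measurable_finite_valued (fun i : 'I_k => i%:R : R) mN).
have L2f : L2 m f.
  have [mR mI] := mf; split => //.
  apply: (@le_lt_trans _ _ (\int[m]_w (k%:R ^+ 2)%:E)%E).
    apply: ge0_le_integral => //.
    - by move=> w _; rewrite lee_fin sqr_ge0.
    - under eq_fun do rewrite normc_sqn; exact: measurable_sqn.
    move=> w _; rewrite lee_fin normc_sqn /sqn/= expr0n addr0.
    by rewrite ler_sqr ?nnegrE// ler_nat ltnW.
  by rewrite integral_probability_cst ltry.
have [_ apf] := almost_periodic_L2 dyn pps L2f.
move=> eps /apf[J [c H]]; exists J, c => x y /H h.
apply: le_lt_trans h.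
have mNx z i : measurable ((fun w => N (alpha z w)) @^-1` [set i]).
  rewrite -[_ @^-1` _]setTI.
  exact: (measurable_shift dyn z measurableT (mN i)).
have mD := measurable_disagree (mNx x) (mNx y).
rewrite -[X in m X]setIT -integral_indic//.
apply: ge0_le_integral => //.
- exact/measurable_EFinP.
- apply: measurable_sqn; apply: cmeasurableB;
    exact: (cmeasurable_shift dyn _ mf).
move=> w _; rewrite lee_fin indicE; have [|] := boolP (w \in _); last first.
  by rewrite sqn_ge0.
rewrite inE /= => Nxy.
rewrite /sqn /= subrr expr0n addr0 -[(_ - _) ^+ 2]real_normK ?num_real//.
rewrite -[leLHS](expr1n _ 2) ler_sqr ?nnegrE//.
have /eqP : nat_of_ord (N (alpha x w)) <> N (alpha y w) by move/val_inj.
rewrite neq_ltn => /orP[] h; last first.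
  rewrite ger0_norm ?subr_ge0 ?ler_nat 1?ltnW//.
  by rewrite -natrB 1?ltnW// ler1n subn_gt0.
rewrite distrC ger0_norm ?subr_ge0 ?ler_nat 1?ltnW//.
by rewrite -natrB 1?ltnW// ler1n subn_gt0.
Qed.

Lemma box_entropy_le (k : nat) (P : 'I_k -> set T) :
  measurable_partition P -> forall eta : R, 0 < eta ->
  exists C : R, forall n,
    partition_entropy m (@box_join R d disp T alpha _ P n) <=
    C + (n ^ d)%:R * eta.
Proof.
move=> mP eta eta0; have [mPi _ _] := mP.
have [N PN] := partition_index mP.
have mN i : measurable (N @^-1` [set i]) by rewrite -PN.
(* Without pieces the space would be empty, contradicting total mass 1. *)
have k0 : (0 < k)%N.
  rewrite lt0n; apply/eqP => k0.
  have : (m setT = 0)%E.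
    rewrite -(measure0 m); congr (m _); apply/seteqP; split => // w _.
    have := leq_ltn_trans (leq0n _) (ltn_ord (N w)).
    by rewrite [X in (_ < X)%N]k0.
  by rewrite (@probability_setT _ _ _ m) => /eqP; rewrite onee_eq0.
(* Chosen so that a correct symbol costs [- ln (1 - delta) = eta / 2]; [eps] below makes the
   mismatches cost another [eta / 2] per symbol. *)
pose delta := 1 - expR (- (eta / 2)).
have eta2 : 0 < eta / 2 by rewrite divr_gt0.
have delta0 : 0 < delta by rewrite subr_gt0 expR_lt1 oppr_lt0.
have delta1 : delta < 1 by rewrite gtrBl expR_gt0.
have lndelta : - ln (1 - delta) = eta / 2.
  by rewrite /delta opprB addrC subrK expRK opprK.
have kd : 0 < ln (k%:R / delta).
  rewrite ln_gt0// ltr_pdivlMr// mul1r (lt_le_trans delta1)//.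
  by rewrite ler1n.
pose eps := eta / 2 / ln (k%:R / delta).
have eps0 : 0 < eps by rewrite divr_gt0.
have [J [c Hc]] := index_colouring mN eps0.
have [y yc] := colouring_section c.
(* The colour set [J] was fixed before [n], so this constant serves all boxes. *)
exists (ln (#|{ffun J -> 'I_k}|%:R)) => n.
rewrite (box_join_index n PN).
have mNx x i : measurable ((fun w => N (alpha x w)) @^-1` [set i]).
  rewrite -[_ @^-1` _]setTI.
  exact: (measurable_shift dyn x measurableT (mN i)).
have := @join_entropy_le R disp T m 'rV['I_n]_d J 'I_k
  (fun x w => N (alpha (lattice_point R x) w)) (fun j w => N (alpha (y j) w))
  (fun x => c (lattice_point R x)) (fun x i => mNx _ i) (fun j i => mNx _ i).
rewrite card_ord => /(_ k0 delta delta0 delta1 eps (ltW eps0)).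
rewrite lndelta card_mx card_ord mul1n.
have -> : ln (k%:R / delta) * eps = eta / 2.
  by rewrite /eps mulrC divfK// gt_eqF.
have -> : eta / 2 + eta / 2 = eta by field.
by apply => x; apply/ltW/Hc; rewrite yc.
Qed.

Lemma box_entropy_dim0 (k : nat) (P : 'I_k -> set T) n :
  d = 0%N -> ergodic alpha m -> measurable_partition P ->
  partition_entropy m (@box_join R d disp T alpha _ P n) = 0.
Proof.
move=> d0 erg mP; have [mPi _ _] := mP.
have alpha_id x w : alpha x w = w.
  have [[a0 _ _] _] := dyn.
  rewrite -[RHS]a0; congr (alpha _ w); apply/rowP => i.
  by have := ltn_ord i; rewrite {2}d0.
rewrite /partition_entropy big1 ?oppr0// => phi _.
have mA : measurable (@box_join R d disp T alpha _ P n phi).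
  apply: fin_bigcap_measurable => // x _.
  rewrite -[_ @^-1` _]setTI.
  exact: (measurable_shift dyn _ measurableT (mPi _)).
(* A piece of measure 0 or 1 contributes nothing, as [ln 1 = 0]. *)
case: (erg _ mA) => [x| -> | ->]; rewrite ?mul0r ?ln1 ?mulr0//.
have -> : alpha x @^-1` box_join alpha P phi = box_join alpha P phi.
  by apply/seteqP; split => w; rewrite /preimage/= alpha_id.
by rewrite setYK measure0.
Qed.

Lemma entropy_rate0 (k : nat) (P : 'I_k -> set T) :
  ergodic alpha m -> measurable_partition P ->
  partition_entropy_rate alpha m P = 0.
Proof.
move=> erg mP; apply/cvg_lim => //.
(* For [d = 0] the divisor [n ^ d] is constantly 1 and would not absorb the constant [C]. *)
have [d0|d0] := posnP d.
  under eq_fun do rewrite (box_entropy_dim0 _ d0 erg mP) mul0r.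
  exact: cvg_cst.
have H0 n : 0 <= partition_entropy m (@box_join R d disp T alpha _ P n).
  apply: partition_entropy_ge0 => phi; apply: fin_bigcap_measurable => // x _.
  rewrite -[_ @^-1` _]setTI.
  by have [mPi _ _] := mP; exact: (measurable_shift dyn _ measurableT (mPi _)).
apply/cvgrPdist_le => e e0.
have e2 : 0 < e / 2 by rewrite divr_gt0.
have [C HC] := box_entropy_le mP e2.
near=> n.
have n0 : (0 < n)%N by near: n; exact: nbhs_infty_gt.
have nd0 : 0 < (n ^ d)%:R :> R by rewrite ltr0n expn_gt0 n0.
(* For such [n] the constant is at most [n * (e / 2)], hence at most half of [e * n ^ d] because
   [d > 0]. *)
have nC : C / (e / 2) <= n%:R by near: n; exact: nbhs_infty_ger.
rewrite sub0r normrN ger0_norm ?divr_ge0 ?ler0n//.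
rewrite ler_pdivrMr//; apply: le_trans (HC n) _.
have nnd : n%:R <= (n ^ d)%:R :> R.
  by rewrite ler_nat -{1}(expn1 n) leq_pexp2l.
rewrite ler_pdivrMr// in nC.
have -> : e * (n ^ d)%:R = (n ^ d)%:R * (e / 2) + (n ^ d)%:R * (e / 2) by field.
by rewrite lerD2r (le_trans nC)// ler_pM2r.
Unshelve. all: by end_near.
Qed.

End entropy.

Theorem theorem4 (R : realType) (d : nat) (disp : measure_display)
    (Omega : measurableType disp) (alpha : 'rV[R]_d -> Omega -> Omega)
    (m : probability Omega R) :
  measurable_dynamical_system alpha m ->
  ergodic alpha m ->
  countable_pure_point_spectrum alpha m ->
  metric_entropy alpha m = 0%E.
Proof.
move=> dyn erg pps.
rewrite /metric_entropy.
suff -> : [set h | exists (k : nat) (P : 'I_k -> set Omega),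
    measurable_partition P /\ h = (partition_entropy_rate alpha m P)%:E] =
    [set 0%E] by rewrite ereal_sup1.
apply/seteqP; split => [h [k [P [mP ->]]]|_ ->].
  by rewrite entropy_rate0.
(* The one-piece partition shows that the set of rates is nonempty; otherwise its supremum would be
   [-oo]. *)
have mP : measurable_partition (fun _ : 'I_1 => [set: Omega]).
  split => //; last by rewrite bigcup_const//; exists ord0.
  by apply/trivIsetP => i j _ _; rewrite !ord1 eqxx.
by exists 1%N, (fun=> setT); split => //; rewrite entropy_rate0.
Qed.
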